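(* Let $\mathcal T\subseteq M_n(\mathbb C)$ be the subspace of all $n\times n$ Toeplitz matrices. If $\varphi:\mathcal T\to M_n(\mathbb C)$ is a linear isometry, then there are unitaries $U,V\in M_n(\mathbb C)$ such that $\varphi(T)=UTV$ for every $T\in\mathcal T$.
   Context: An $n\times n$ Toeplitz matrix is a matrix $(t_{ij})$ whose entries depend only on $i-j$. $M_n(\mathbb C)$ carries the operator norm induced by the Euclidean norm on $\mathbb C^n$; a linear isometry is a linear map with $\|\varphi(T)\|=\|T\|$ for all $T$. *)

(* Defs.v *)
From HB Require Import structures.
From mathcomp Require Import all_boot all_order all_algebra.
Set Implicit Arguments. Unset Strict Implicit. Unset Printing Implicit Defensive.
Import Order.TTheory GRing.Theory Num.Theory.
Local Open Scope ring_scope.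

Definition toeplitz (C : numClosedFieldType) (n : nat) (T : 'M[C]_n) : Prop :=
  forall i j k l : 'I_n, (i%:Z - j%:Z = k%:Z - l%:Z)%R -> T i j = T k l.

Definition vnorm2 (C : numClosedFieldType) (n : nat) (v : 'cV[C]_n) : C :=
  \sum_(i < n) `|v i 0| ^+ 2.

Definition is_opnorm (C : numClosedFieldType) (n : nat) (A : 'M[C]_n) (c : C) : Prop :=
  [/\ 0 <= c,
      (forall v : 'cV[C]_n, vnorm2 (A *m v) <= c ^+ 2 * vnorm2 v) &
      (forall d : C, 0 <= d ->
         (forall v : 'cV[C]_n, vnorm2 (A *m v) <= d ^+ 2 * vnorm2 v) -> c <= d)].

Definition adjoint (C : numClosedFieldType) (n : nat) (A : 'M[C]_n) : 'M[C]_n :=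
  map_mx Num.conj (A^T).

Definition unitary (C : numClosedFieldType) (n : nat) (U : 'M[C]_n) : Prop :=
  U *m adjoint U = 1%:M /\ adjoint U *m U = 1%:M.

(* Main.v *)
(** Let S be the shift and S' its adjoint.  For a unit scalar w and
    0 <= k <= n, the w-circulants S^k + w S'^(n-k) are Toeplitz and simultaneously diagonal in a Fourier
    basis u_j, and the projections u_j u_j^* are Toeplitz too.  An isometry sends
    these n projections to matrices F_j of norm 1 such that F_j + F_k and
    F_j - F_k have norm 1, which forces F_j = y_j x_j^* with (x_j) and (y_j)
    orthonormal.  So on w-circulants phi acts by T |-> U_w T V_w; in particular
    W = phi(1) is unitary and W^* phi is a *-homomorphism on w-circulants for
    each w.
    Comparing w = 1, -1, i gives, for A_k = W^* phi(S^k) and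
    B_k = W^* phi(S'^(n-k)), the identities A_k A_l = A_(k+l),
    A_k B_l + B_k A_l = B_(k+l), B_k B_l = 0 (k + l <= n) and A_k^* = B_(n-k).
    For a unit vector v in the range of B_1 they give B_k v = 0 for k < n, hence
    <A_i v, A_j v> = <v, B_(n-i) A_j v> = <v, B_(n-i+j) v>, which is 1 if i = j
    and 0 if j < i: the A_k v form an orthonormal basis on which A_k acts as S^k. *)
Require Import Defs.
From HB Require Import structures.
From mathcomp Require Import all_boot all_order all_algebra.
From mathcomp Require Import separable cyclotomic ring zify.
Set Implicit Arguments.
Unset Strict Implicit.
Unset Printing Implicit Defensive.
Import Order.TTheory GRing.Theory Num.Theory.
Local Open Scope ring_scope.
Local Open Scope sesquilinear_scope.

(** * Inner product, unitaries and vectors attaining the norm *)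

Definition dot {C : numClosedFieldType} {n : nat} (u v : 'cV[C]_n) : C :=
  (u^t* *m v) 0 0.

Section Dot.
Variables (C : numClosedFieldType) (n : nat).
Implicit Types (u v w : 'cV[C]_n) (A M : 'M[C]_n).

Lemma adjoint_mul p q r (A : 'M[C]_(p, q)) (B : 'M[C]_(q, r)) :
  (A *m B)^t* = B^t* *m A^t*.
Proof. by rewrite trmx_mul map_mxM. Qed.

Lemma dotE u v : dot u v = \sum_i (u i 0)^* * v i 0.
Proof. by rewrite /dot mxE; apply: eq_bigr => i _; rewrite !mxE. Qed.

Lemma vnorm2E v : vnorm2 v = dot v v.
Proof. by rewrite dotE; apply: eq_bigr => i _; rewrite normCKC. Qed.

Lemma dot_conj u v : (dot u v)^* = dot v u.
Proof.
rewrite !dotE rmorph_sum; apply: eq_bigr => i _.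
by rewrite rmorphM /= conjCK mulrC.
Qed.

Lemma dotDr u v w : dot u (v + w) = dot u v + dot u w.
Proof. by rewrite /dot mulmxDr mxE. Qed.

Lemma dotZr a u v : dot u (a *: v) = a * dot u v.
Proof. by rewrite /dot -scalemxAr mxE. Qed.

Lemma dot0r u : dot u 0 = 0.
Proof. by rewrite /dot mulmx0 mxE. Qed.

Lemma dotDl u v w : dot (u + v) w = dot u w + dot v w.
Proof. by rewrite -dot_conj dotDr rmorphD /= !dot_conj. Qed.

Lemma dotZl a u v : dot (a *: u) v = a^* * dot u v.
Proof. by rewrite -dot_conj dotZr rmorphM /= dot_conj. Qed.

Lemma dot_mulmx A u v : dot (A *m u) v = dot u (A^t* *m v).
Proof. by rewrite /dot adjoint_mul mulmxA. Qed.

Lemma dot_ge0 v : 0 <= dot v v.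
Proof. by rewrite -vnorm2E sumr_ge0 // => i _; rewrite exprn_ge0. Qed.

Lemma dot_eq0 v : (dot v v == 0) = (v == 0).
Proof.
apply/eqP/eqP => [|->]; last by rewrite dot0r.
rewrite -vnorm2E => /psumr_eq0P v0; apply/colP => i; rewrite mxE.
have /eqP := v0 (fun i _ => exprn_ge0 _ (normr_ge0 _)) i isT.
by rewrite expf_eq0 normr_eq0 => /eqP.
Qed.

Lemma unit_vector v : v != 0 -> exists a, dot (a *: v) (a *: v) = 1.
Proof.
rewrite -dot_eq0 => nz; exists (sqrtC (dot v v))^-1.
rewrite dotZl dotZr mulrA -normCKC normfV exprVn ger0_norm ?sqrtC_ge0 ?dot_ge0 //.
by rewrite sqrtCK mulVf.
Qed.

Lemma unitary_of_mulmx M : M^t* *m M = 1%:M -> unitary M.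
Proof. by move=> MM; split=> //; apply: mulmx1C. Qed.

Lemma orthonormal_unitary (f : 'I_n -> 'cV[C]_n) :
    (forall i j, dot (f i) (f j) = (i == j)%:R) ->
  unitary (\matrix_(i, j) f j i 0).
Proof.
move=> ortho; apply: unitary_of_mulmx; apply/matrixP=> i j.
rewrite !mxE -ortho dotE.
by apply: eq_bigr => k _; rewrite !mxE.
Qed.

Lemma unitary_adjoint M : unitary M -> unitary (M^t*).
Proof. by rewrite /unitary /adjoint trmxCK => -[? ?]; split. Qed.

Lemma unitary_mul M N : unitary M -> unitary N -> unitary (M *m N).
Proof.
rewrite /unitary /adjoint => -[M1 M2] [N1 N2]; rewrite adjoint_mul !mulmxA.
by rewrite -(mulmxA M) N1 mulmx1 M1 -(mulmxA (N^t*)) M2 mulmx1 N2.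
Qed.

(** [A^t* *m A] is normal, so it has an orthonormal eigenbasis, with eigenvalues in [0, 1]. If none
    of them were 1, a constant below 1 would bound [A], against minimality. *)
Lemma opnorm_attained A : is_opnorm A 1 ->
  exists2 x, dot x x = 1 & A^t* *m A *m x = x.
Proof.
move=> [_ leA minA]; set H := A^t* *m A.
have /orthomx_spectralP : H \is normalmx.
  by apply/normalmxP; rewrite /H !adjoint_mul trmxCK.
have /unitarymxP := spectral_unitarymx H.
have := spectral_unitarymx H; move/invmx_unitary=> ->.
move: (spectralmx H) (spectral_diag H) => P d PP HE.
have P'P := mulmx1C PP.
pose x i := P^t* *m delta_mx i 0 : 'cV_n.
have x1 i : dot (x i) (x i) = 1.
  rewrite /x dot_mulmx trmxCK mulmxA PP mul1mx dotE (bigD1 i) //=.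
  rewrite !mxE !eqxx /= mulr1 conjC1 big1 ?addr0 // => k ki.
  by rewrite !mxE (negPf ki) /= mulr0.
have Hx i : H *m x i = d 0 i *: x i.
  rewrite HE /x !mulmxA -(mulmxA _ P) PP mulmx1 -mulmxA.
  rewrite mul_diag_mx scalemxAr; congr (_ *m _).
  apply/colP=> k; rewrite !mxE eqxx andbT.
  by case: eqP => [->|]; rewrite ?mulr0.
have [/existsP[i /eqP di]|/existsPn d1] := boolP [exists i, d 0 i == 1].
  by exists (x i); rewrite ?x1 // Hx di scale1r.
have dge i : d 0 i = vnorm2 (A *m x i).
  by rewrite vnorm2E dot_mulmx mulmxA Hx dotZr x1 mulr1.
have d_ge0 i : 0 <= d 0 i by rewrite dge vnorm2E dot_ge0.
have d_lt1 i : 0 < 1 - d 0 i.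
  rewrite subr_gt0 lt_neqAle d1 dge /=; apply: le_trans (leA _) _.
  by rewrite vnorm2E x1 expr1n mulr1.
(* The order of [C] is partial, so the largest eigenvalue is replaced by the
   bound [1 - p], still smaller than 1. *)
pose p := \prod_i (1 - d 0 i).
have p_gt0 : 0 < p by apply: prodr_gt0.
have q_le1 (Q : pred 'I_n) : \prod_(i | Q i) (1 - d 0 i) <= 1.
  by apply: prodr_ile1 => i; rewrite ltW //= gerBl.
have d_le i : d 0 i <= 1 - p.
  rewrite lerBrDr -lerBrDl /p (bigD1 i) //=.
  by rewrite ler_piMr // ltW.
have p_le1 : 0 <= 1 - p by rewrite subr_ge0 q_le1.
suff: (1 : C) <= sqrtC (1 - p).
  rewrite -(@ler_pXn2r _ 2) ?nnegrE ?sqrtC_ge0 ?ler01 // sqrtCK expr1n.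
  by rewrite lerBrDr gerDl => /(lt_le_trans p_gt0); rewrite ltxx.
apply: minA => [|v]; rewrite ?sqrtC_ge0 // sqrtCK !vnorm2E dot_mulmx mulmxA.
have -> : dot v v = dot (P *m v) (P *m v) by rewrite dot_mulmx mulmxA P'P mul1mx.
rewrite -/H HE -!mulmxA -dot_mulmx !dotE mulr_sumr; apply: ler_sum => i _.
rewrite mul_diag_mx; set w := P *m v.
have -> : (\matrix_(k, j) (d 0 k * w k j)) i 0 = d 0 i * w i 0 by rewrite mxE.
by rewrite mulrCA ler_wpM2r // -normCKC exprn_ge0.
Qed.
End Dot.

(** * Families with the norm pattern of orthogonal rank-one projections *)

Section OrthogonalRankOne.
Variables (C : numClosedFieldType) (n : nat).
Implicit Types (x y v : 'cV[C]_n) (A : 'M[C]_n).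

Lemma opnorm1 A x :
    (forall v, vnorm2 (A *m v) <= vnorm2 v) ->
    vnorm2 x = 1 -> vnorm2 (A *m x) = 1 ->
  is_opnorm A 1.
Proof.
move=> leA x1 Ax1; split=> // [v|d d_ge0 /(_ x)]; first by rewrite expr1n mul1r.
by rewrite x1 Ax1 mulr1 -{1}(expr1n C 2) ler_pXn2r ?nnegrE ?ler01.
Qed.

Lemma opnorm1_le A v : is_opnorm A 1 -> dot (A *m v) (A *m v) <= dot v v.
Proof. by case=> _ /(_ v); rewrite expr1n mul1r !vnorm2E. Qed.

Lemma parallelogram x y : dot (x + y) (x + y) + dot (x - y) (x - y) =
  (dot x x + dot y y) *+ 2.
Proof.
rewrite -[- y]scaleN1r !(dotDr, dotDl, dotZl, dotZr) rmorphN1.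
by ring.
Qed.

(** Unit vectors [x j] at which [F j] attains its norm become the columns of [X], and their images
    those of [Y]. The bounds on sums and differences force [F k] to vanish at [x j] and the images
    to be orthogonal. *)
Lemma orthogonal_rank_one (F : 'I_n -> 'M[C]_n) :
    (forall j, is_opnorm (F j) 1) ->
    (forall j k, j != k -> is_opnorm (F j + F k) 1) ->
    (forall j k, j != k -> is_opnorm (F j - F k) 1) ->
  exists X Y, [/\ unitary X, unitary Y &
    forall j, F j = Y *m delta_mx j j *m X^t*].
Proof.
move=> F1 FD FB.
have [x x1 FFx] := fin_all_exists2 (fun j => opnorm_attained (F1 j)).
have y1 j : dot (F j *m x j) (F j *m x j) = 1.
  by rewrite dot_mulmx mulmxA FFx x1.
have Fx j k : k != j -> F k *m x j = 0.
  move=> kj; apply/eqP; rewrite -dot_eq0 eq_le dot_ge0 andbT.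
  (* By the parallelogram law the two left-hand sides add up to 2 + 2 |F_k x_j|^2, while the bounds
     add up to 2. *)
  have := lerD (opnorm1_le (x j) (FD j k _)) (opnorm1_le (x j) (FB j k _)).
  rewrite mulmxDl mulmxBl parallelogram y1 x1 eq_sym => /(_ kj kj).
  by rewrite -mulr2n lerMn2r /= gerDl.
have xx j k : dot (x j) (x k) = (j == k)%:R.
  (* Writing x_j as F_j^* F_j x_j moves [F j] onto [x k], which it kills. *)
  case: eqVneq => [->//|jk]; rewrite -(FFx j) -mulmxA dot_mulmx trmxCK.
  by rewrite (Fx k j) // dot0r.
have yy j k : dot (F j *m x j) (F k *m x k) = (j == k)%:R.
  case: eqVneq => [->//|jk]; set z := dot _ _.
  (* The squared norms of both sides are [1 + 3 |z|^2] and [1 + |z|^2]. *)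
  have := opnorm1_le (x j + z^* *: x k) (FD j k jk).
  rewrite !mulmxDl !mulmxDr -!scalemxAr (Fx _ _ jk) (Fx j k) 1?eq_sym //.
rewrite scaler0 addr0 add0r !(dotDr, dotDl, dotZl, dotZr) !xx !y1 !eqxx.
  rewrite eq_sym (negPf jk) -(dot_conj (F j *m _)) -/z conjCK.
  rewrite !mulr0 !mulr1 addr0 add0r gerDl [z^* * z]mulrC -mulr2n -normCK.
  rewrite pmulrn_lle0 // => z_le0; apply/eqP.
  by rewrite -normr_eq0 -sqrf_eq0 eq_le z_le0 exprn_ge0.
have X_unitary := orthonormal_unitary xx.
have Y_unitary := orthonormal_unitary yy.
exists (\matrix_(i, j) x j i 0), (\matrix_(i, j) (F j *m x j) i 0); split=> // j.
set X := (\matrix_(i, j) x j i 0).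
have [+ _] := X_unitary => XX.
(* After cancelling X^*, both sides have F_j x_j as column [j] and zeros elsewhere. *)
rewrite -[LHS]mulmx1 -XX mulmxA; congr (_ *m _); apply/matrixP=> i k.
rewrite [RHS]mxE (bigD1 j) //= big1 => [|l lj]; last first.
  by rewrite [delta_mx _ _ _ _]mxE (negPf lj) mulr0.
rewrite addr0 !mxE eqxx /=.
transitivity ((F j *m x k) i 0).
  by rewrite mxE; apply: eq_bigr => l _; rewrite !mxE.
case: eqVneq => [->|kj]; first by rewrite mxE mulr1.
by rewrite Fx 1?eq_sym // mxE mulr0.
Qed.
End OrthogonalRankOne.

(** * Isometries on Toeplitz matrices that are diagonal in one orthonormal basis *)

Section Toeplitz.
Variables (C : numClosedFieldType) (n : nat).
Implicit Types (S T M A : 'M[C]_n) (d : 'rV[C]_n).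

Lemma toeplitz0 : toeplitz (0 : 'M[C]_n).
Proof. by move=> i j k l _; rewrite !mxE. Qed.

Lemma toeplitzD S T : toeplitz S -> toeplitz T -> toeplitz (S + T).
Proof. by move=> tS tT i j k l e; rewrite !mxE (tS _ _ _ _ e) (tT _ _ _ _ e). Qed.

Lemma toeplitzZ a T : toeplitz T -> toeplitz (a *: T).
Proof. by move=> tT i j k l e; rewrite !mxE (tT _ _ _ _ e). Qed.

Lemma toeplitz_sum (I : Type) (r : seq I) (P : pred I) (T : I -> 'M[C]_n) :
  (forall i, P i -> toeplitz (T i)) -> toeplitz (\sum_(i <- r | P i) T i).
Proof.
move=> tT; apply: big_ind => //; [exact: toeplitz0 | exact: toeplitzD].
Qed.

Variable phi : 'M[C]_n -> 'M[C]_n.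
Hypothesis phi_lin : forall (a : C) (S T : 'M[C]_n), toeplitz S -> toeplitz T ->
  phi (a *: S + T) = a *: phi S + phi T.

Lemma toeplitz_linD S T : toeplitz S -> toeplitz T -> phi (S + T) = phi S + phi T.
Proof. by move=> tS tT; rewrite -{1}(scale1r S) phi_lin // scale1r. Qed.

Lemma toeplitz_lin0 : phi 0 = 0.
Proof.
by apply: (addrI (phi 0)); rewrite -(toeplitz_linD toeplitz0 toeplitz0) !addr0.
Qed.

Lemma toeplitz_linZ a T : toeplitz T -> phi (a *: T) = a *: phi T.
Proof.
by move=> tT; rewrite -[a *: T]addr0 phi_lin ?toeplitz_lin0 ?addr0 //; apply: toeplitz0.
Qed.

Lemma toeplitz_lin_sum (I : Type) (r : seq I) (T : I -> 'M[C]_n) :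
  (forall i, toeplitz (T i)) -> phi (\sum_(i <- r) T i) = \sum_(i <- r) phi (T i).
Proof.
move=> tT; elim: r => [|i r IH]; rewrite ?big_nil ?toeplitz_lin0 // !big_cons.
by rewrite toeplitz_linD ?IH //; apply: toeplitz_sum.
Qed.

Hypothesis phi_iso : forall (T : 'M[C]_n) (c : C), toeplitz T ->
  (is_opnorm (phi T) c <-> is_opnorm T c).

Lemma opnorm_diag M d j : unitary M -> (forall i, `|d 0 i| <= 1) -> `|d 0 j| = 1 ->
  is_opnorm (M *m diag_mx d *m M^t*) 1.
Proof.
rewrite /unitary /adjoint => -[MM MM'] d_le1 dj1.
have norm_mul A v : A^t* *m A = 1%:M -> vnorm2 (A *m v) = vnorm2 v.
  by move=> AA; rewrite !vnorm2E dot_mulmx mulmxA AA mul1mx.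
apply: (@opnorm1 _ _ _ (M *m delta_mx j 0)) => [v||].
- rewrite -!mulmxA norm_mul // -[leRHS](norm_mul (M^t*)) ?trmxCK //.
  apply: ler_sum => i _; rewrite mul_diag_mx; set w := _ *m v.
  rewrite mxE normrM exprMn ler_piMl ?exprn_ge0 //.
  by rewrite exprn_ile1.
- rewrite norm_mul // /vnorm2 (bigD1 j) //= mxE !eqxx normr1 expr1n.
  by rewrite big1 ?addr0 // => i ij; rewrite mxE (negPf ij) normr0 expr0n.
- rewrite mulmxA -(mulmxA _ (M^t*)) MM' mulmx1 -mulmxA norm_mul // mul_diag_mx.
  rewrite /vnorm2 (bigD1 j) //= !mxE !eqxx mulr1 dj1 expr1n.
  by rewrite big1 ?addr0 // => i ij; rewrite !mxE (negPf ij) mulr0 normr0 expr0n.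
Qed.

(** When [d] runs over the basis vectors, these matrices are mutually orthogonal rank-one
    projections, so their images fall under [orthogonal_rank_one]; linearity then reaches every
    [d]. *)
Lemma isometry_diag M : unitary M ->
    (forall d, toeplitz (M *m diag_mx d *m M^t*)) ->
  exists X Y, [/\ unitary X, unitary Y &
    forall d, phi (M *m diag_mx d *m M^t*) = Y *m diag_mx d *m X^t*].
Proof.
move=> uM tM; pose G d := M *m diag_mx d *m M^t*.
have tG d : toeplitz (G d) by apply: tM.
pose e j : 'rV[C]_n := delta_mx 0 j.
have GD a d1 d2 : G (a *: d1 + d2) = a *: G d1 + G d2.
  by rewrite /G linearP /= mulmxDr mulmxDl -scalemxAr -scalemxAl.
have phiG a d1 d2 : phi (G (a *: d1 + d2)) = a *: phi (G d1) + phi (G d2).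
  by rewrite GD phi_lin.
have G1 a j k : `|a| = 1 -> j != k -> is_opnorm (phi (G (a *: e k + e j))) 1.
  move=> a1 jk; apply/phi_iso => //; apply: (@opnorm_diag _ _ j) => // [i|].
    rewrite !mxE /=; have [->|] := eqVneq i j.
      by rewrite (negPf jk) mulr0 add0r normr1.
    by move=> _; case: eqP => _; rewrite ?mulr1 ?mulr0 addr0 ?normr0 ?a1 ?ler01.
  by rewrite !mxE /= eqxx (negPf jk) mulr0 add0r normr1.
have [j|j k jk|j k jk|X [Y [uX uY FE]]] :=
  @orthogonal_rank_one _ _ (fun j => phi (G (e j))).
- apply/phi_iso => //; apply: (@opnorm_diag _ _ j) => // [i|].
    by rewrite !mxE /=; case: eqP; rewrite ?normr1 ?normr0 ?ler01.
  by rewrite !mxE !eqxx normr1.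
- by rewrite addrC -[phi (G (e k))]scale1r -phiG; apply: G1; rewrite ?normr1.
- by rewrite addrC -scaleN1r -phiG; apply: G1; rewrite ?normrN1.
exists X, Y; split=> // d.
have dE : diag_mx d = \sum_j d 0 j *: diag_mx (e j).
  by rewrite {1}[d]row_sum_delta linear_sum; apply: eq_bigr => j _; rewrite linearZ_LR.
rewrite {1}dE mulmx_sumr mulmx_suml.
under eq_bigr do rewrite -scalemxAr -scalemxAl.
rewrite toeplitz_lin_sum => [|j]; last by apply: toeplitzZ; apply: tM.
rewrite dE mulmx_sumr mulmx_suml; apply: eq_bigr => j _.
rewrite -scalemxAr -scalemxAl toeplitz_linZ; last exact: tM.
rewrite FE; congr (_ *: (_ *m _ *m _)); apply/matrixP=> i k; rewrite !mxE eqxx /=.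
have [<-|ik] := eqVneq i k; first by rewrite andbb mulr1n.
by have [<-|//] := eqVneq i j; rewrite eq_sym (negPf ik).
Qed.
End Toeplitz.

(** * Roots of a unimodular scalar and the Fourier basis *)

Section Fourier.
Variable C : numClosedFieldType.

(** One n-th root of [w] is multiplied by the n roots of unity, which are distinct because X^n - 1
    is separable in characteristic zero. *)
Lemma distinct_roots n (w : C) : (0 < n)%N -> w != 0 ->
  exists2 mu : 'I_n -> C, injective mu & forall j, mu j ^+ n = w.
Proof.
move=> n_gt0 w_neq0; pose p : {poly C} := 'X^n - 1.
have [r Dp] := closed_field_poly_normal p.
have mon_p := monic_Xn_sub_1 C n_gt0.
rewrite (monicP mon_p) scale1r in Dp.
have sz_r : size r = n by apply: succn_inj; rewrite -(size_Xn_sub_1 C n_gt0) -/p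
    Dp (size_prod_XsubC r id).
have uniq_r : uniq r.
  by rewrite -separable_prod_XsubC -Dp separable_Xn_sub_1 // pnatr_eq0 -lt0n.
have root_neq0 : n.-root w != 0 by rewrite rootC_eq0.
exists (fun j => n.-root w * r`_j) => [i j /(mulfI root_neq0)/eqP|j].
  by rewrite nth_uniq ?sz_r // => /eqP/val_inj.
have: root p r`_j by rewrite Dp root_prod_XsubC mem_nth ?sz_r.
rewrite rootE !hornerE subr_eq0 => /eqP rj.
by rewrite exprMn rootCK // rj mulr1.
Qed.

(** For unimodular [x], x^-i x^j is, up to a constant factor, the entry (i, j) of the projection
    onto a Fourier vector; it depends only on i - j. *)
Lemma exprV_mul_expr (x : C) i j k l : x != 0 -> (i + l = k + j)%N ->
  x^-1 ^+ i * x ^+ j = x^-1 ^+ k * x ^+ l.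
Proof.
move=> x_neq0 e; rewrite !exprVn ![_^-1 * _]mulrC; apply/eqP.
by rewrite eqr_div ?expf_neq0 // -!exprD addnC -e addnC.
Qed.

Lemma sum_delta n a (f : nat -> C) :
  \sum_(l < n) (l == a :> nat)%:R * f l = if (a < n)%N then f a else 0.
Proof.
case: ltnP => [lt_an|le_na].
  rewrite (bigD1 (Ordinal lt_an)) //= eqxx mul1r big1 ?addr0 // => l.
  by rewrite -val_eqE /= => /negPf ->; rewrite mul0r.
by rewrite big1 // => l _; rewrite ltn_eqF ?mul0r // (leq_trans (ltn_ord l)).
Qed.

(** This is S^k, given by its entries rather than as a power; it is 0 once [k] reaches [n], and its
    transpose is S'^k. *)
Definition shift n k : 'M[C]_n := \matrix_(i, j) (i == (j + k)%N :> nat)%:R.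

(** The eigenvectors have entries proportional to mu_j^-i. Moving entries down by [k] multiplies
    them by mu_j^k, and those that wrap around agree because they carry the factor w = mu_j^n. *)
Lemma fourier_circulant n (w : C) : (0 < n)%N -> `|w| = 1 ->
  exists M (mu : 'I_n -> C), [/\ unitary M,
    forall j, `|mu j| = 1 /\ mu j ^+ n = w,
    forall d, toeplitz (M *m diag_mx d *m M^t*) &
    forall k, (k <= n)%N -> shift n k + w *: (shift n (n - k))^T =
       M *m diag_mx (\row_j mu j ^+ k) *m M^t*].
Proof.
move=> n_gt0 w1.
have w_neq0 : w != 0 by rewrite -normr_eq0 w1 oner_eq0.
have [mu mu_inj mu_n] := distinct_roots n_gt0 w_neq0.
have mu1 j : `|mu j| = 1.
  by apply/eqP; rewrite -(pexpr_eq1 n_gt0) // -normrX mu_n w1.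
have mu_neq0 j : mu j != 0 by rewrite -normr_eq0 mu1 oner_eq0.
have mu_conj j : (mu j)^* = (mu j)^-1 by rewrite invC_norm mu1 expr1n invr1 mul1r.
pose s : C := (sqrtC n%:R)^-1.
have ss : s^* * s * n%:R = 1.
  rewrite -normCKC ger0_norm ?invr_ge0 ?sqrtC_ge0 ?ler0n //.
  by rewrite exprVn sqrtCK mulVf // pnatr_eq0 -lt0n.
clearbody s; pose M : 'M[C]_n := \matrix_(i, j) (s * (mu j)^-1 ^+ i).
have uM : unitary M.
  apply: unitary_of_mulmx; apply/matrixP=> i j; rewrite !mxE.
  pose q := mu i / mu j.
  transitivity (s^* * s * \sum_(l < n) q ^+ l).
    rewrite mulr_sumr; apply: eq_bigr => l _; rewrite !mxE rmorphM rmorphXn /=.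
    by rewrite fmorphV /= mu_conj invrK mulrACA -exprMn.
  have [ij|ij] := eqVneq i j.
    rewrite -[RHS]ss /q ij divff //; congr (_ * _).
    by under eq_bigr do rewrite expr1n; rewrite sumr_const card_ord.
  (* [q] is an n-th root of unity, different from 1 by injectivity of [mu], so its geometric sum
     vanishes. *)
  have q1 : q - 1 != 0.
    rewrite subr_eq0; apply: contraNneq ij => q1; apply/eqP/mu_inj.
    by rewrite -[LHS](divfK (mu_neq0 j)) -/q q1 mul1r.
  have -> : \sum_(l < n) q ^+ l = 0; last by rewrite mulr0.
  by apply: (mulfI q1); rewrite mulr0 -subrX1 expr_div_n !mu_n divff // subrr.
have MM' := uM.1; exists M, mu; split=> // [d|k k_le].
  move=> i j k l e; rewrite !mxE; apply: eq_bigr => h _.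
  rewrite !mul_mx_diag !mxE !rmorphM !rmorphXn /= fmorphV /= mu_conj invrK.
  have E x y : s * x * d 0 h * (s^* * y) = s * d 0 h * s^* * (x * y).
    by rewrite (mulrAC s) mulrACA.
  rewrite !E; congr (_ * _).
  apply: exprV_mul_expr => //; move/eqP: e.
  by rewrite subr_eq addrAC eq_sym subr_eq -!PoszD eqz_nat => /eqP.
rewrite -[LHS]mulmx1 -MM' mulmxA; congr (_ *m _); apply/matrixP=> i j.
rewrite mul_mx_diag !mxE.
have inv_k : (mu j)^-1 ^+ (n - k) * w = mu j ^+ k.
  by rewrite -(mu_n j) exprVn -[in mu j ^+ n](subnK k_le) exprD mulKf ?expf_neq0.
under eq_bigr => l _.
  rewrite !mxE mulrDl -mulrA; over.
rewrite big_split -mulr_sumr /= (sum_delta _ _ (fun l => s * (mu j)^-1 ^+ l)).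
have -> : \sum_(l < n) (i == (l + k)%N :> nat)%:R * (s * (mu j)^-1 ^+ l) =
    if (k <= i)%N then s * (mu j)^-1 ^+ (i - k) else 0.
  have [ki|ik] := leqP k i.
    under eq_bigr => l _.
      rewrite -[X in (X == _)%N](subnK ki) eqn_add2r eq_sym; over.
    rewrite (sum_delta _ _ (fun l => s * (mu j)^-1 ^+ l)).
    by rewrite (leq_ltn_trans (leq_subr _ _) (ltn_ord i)).
  rewrite big1 // => l _.
  by rewrite ltn_eqF ?mul0r // (leq_trans ik) // leq_addl.
rewrite -mulrA.
have -> : (i + (n - k) < n)%N = (i < k)%N by rewrite addnC -ltn_subRL subKn.
have [ki|ik] := leqP k i; rewrite ?mulr0 ?addr0 ?add0r.
  congr (_ * _); rewrite -[in RHS](subnK ki) exprD -mulrA -exprMn mulVf //.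
  by rewrite expr1n mulr1.
by rewrite mulrCA exprD [w * _]mulrC -mulrA inv_k.
Qed.
End Fourier.

(** * Decomposition of Toeplitz matrices, and relations that model the shift *)

Section ShiftRelations.
Variables (C : numClosedFieldType) (n : nat).
Implicit Types (T M V : 'M[C]_n).

Lemma toeplitz_shift k : toeplitz (shift C n k).
Proof.
by move=> i j i' j' e; rewrite !mxE; congr (nat_of_bool _)%:R; lia.
Qed.

Lemma toeplitz_tr T : toeplitz T -> toeplitz T^T.
Proof.
move=> tT i j k l e; rewrite !mxE; apply: tT.
by rewrite -opprB e opprB.
Qed.

Lemma shift0 : shift C n 0 = 1%:M.
Proof. by apply/matrixP=> i j; rewrite !mxE addn0. Qed.

Lemma shift_large k : (n <= k)%N -> shift C n k = 0.
Proof.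
move=> nk; apply/matrixP=> i j; rewrite !mxE ltn_eqF //.
by rewrite (leq_trans (ltn_ord i)) // (leq_trans nk) // leq_addl.
Qed.

Lemma toeplitz_basis (n_gt0 : (0 < n)%N) T : toeplitz T ->
  exists a b : 'I_n -> C,
    T = \sum_k (a k *: shift C n k + b k *: (shift C n k)^T).
Proof.
move=> tT; pose o := Ordinal n_gt0.
(* Column 0 supplies the lower diagonals and row 0 the upper ones. The second family vanishes at 0
   because the main diagonal is already counted in the first. *)
exists (fun k => T k o), (fun k => if k == o then 0 else T o k).
apply/matrixP=> i j; rewrite summxE.
have [ji|ij] := leqP j i.
  have lt_ij : (i - j < n)%N by apply: leq_ltn_trans (leq_subr _ _) (ltn_ord i).
  rewrite (bigD1 (Ordinal lt_ij)) //= big1 => [|k].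
    rewrite !mxE /= subnKC // eqxx mulr1 addr0.
    rewrite (tT i j (Ordinal lt_ij) o) /=; last by rewrite subr0 subzn.
    case: eqP => [_|k0]; rewrite ?mul0r ?addr0 //.
    case: eqP => [e|]; rewrite ?mulr0 ?addr0 //.
    by case: k0; apply: val_inj => /=; lia.
  rewrite -val_eqE !mxE /= => kij.
  have -> : (i == j + k :> nat)%N = false by lia.
  have [_|k0] := eqVneq k o; first by rewrite mulr0 mul0r addr0.
  move: k0; rewrite -val_eqE /= => k0.
  have -> : (j == i + k :> nat)%N = false by lia.
  by rewrite !mulr0 addr0.
have lt_ij : (j - i < n)%N by apply: leq_ltn_trans (leq_subr _ _) (ltn_ord j).
rewrite (bigD1 (Ordinal lt_ij)) //= big1 => [|k].
  rewrite !mxE /= subnKC 1?ltnW // eqxx mulr1 addr0 -val_eqE /=.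
  have -> : (i == j + (j - i) :> nat)%N = false by lia.
  have -> : (j - i == 0)%N = false by lia.
  rewrite mulr0 add0r; apply: tT => /=.
  by rewrite -(subzn (ltnW ij)) sub0r opprB.
rewrite -val_eqE !mxE /= => kij.
have -> : (i == j + k :> nat)%N = false by lia.
have -> : (j == i + k :> nat)%N = false by lia.
by rewrite !mulr0 addr0.
Qed.

(** This separates the coefficients of an identity valid for every unimodular [w]: the values at 1
    and -1 isolate [P1], then those at 1 and ['i] isolate [P2]. *)
Lemma unit_circle_poly2 (P0 P1 P2 : 'M[C]_n) :
    (forall w : C, `|w| = 1 -> P0 + w *: P1 + w ^+ 2 *: P2 = 0) ->
  [/\ P0 = 0, P1 = 0 & P2 = 0].
Proof.
move=> P_eq0.
suff H i j : [/\ P0 i j = 0, P1 i j = 0 & P2 i j = 0].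
  by split; apply/matrixP=> i j; have [] := H i j; rewrite mxE.
have entry w : `|w| = 1 -> P0 i j + w * P1 i j + w ^+ 2 * P2 i j = 0.
  by move=> /P_eq0/matrixP/(_ i j); rewrite !mxE.
have := entry 1 (normr1 C); have := entry (-1) (normrN1 C).
have := entry 'i (normCi C); rewrite sqrCi sqrrN expr1n.
move: (P0 i j) (P1 i j) (P2 i j) => p0 p1 p2 ei em e1.
have two_inj (x : C) : x *+ 2 = 0 -> x = 0 by move/eqP; rewrite mulrn_eq0 => /eqP.
have z1 : p1 = 0.
  by apply: two_inj; rewrite -[RHS](subrr 0) -{1}e1 -em; ring.
have z2 : p2 = 0.
  by apply: two_inj; rewrite -[RHS](subrr 0) -{1}e1 -ei z1; ring.
by split=> //; rewrite -e1 z1 z2; ring.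
Qed.

(* [A k] and [B k] stand for the images of [S^k] and [S'^(n-k)]. *)
Lemma shift_model (A B : nat -> 'M[C]_n) :
    A 0%N = 1%:M -> B n = 1%:M -> A n = 0 ->
    (forall k l, (k + l <= n)%N -> A k *m A l = A (k + l)%N) ->
    (forall k l, (k + l <= n)%N -> A k *m B l + B k *m A l = B (k + l)%N) ->
    (forall k l, (k + l <= n)%N -> B k *m B l = 0) ->
    (forall k, (k <= n)%N -> (A k)^t* = B (n - k)%N) ->
  exists2 V, unitary V &
    forall k, (k <= n)%N -> A k = V *m shift C n k *m V^t*.
Proof.
move=> A0 Bn An AA AB BB A_adj.
case: (posnP n) => [n0|n_gt0].
  exists 1%:M; first by split; apply/matrixP=> i; move: (ltn_ord i); rewrite {2}n0.
  by move=> k _; apply/matrixP=> i; move: (ltn_ord i); rewrite {2}n0.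
have B0 : B 0%N = 0 by rewrite -(subnn n) -A_adj // An trmx0 map_mx0.
(* If [B 1] were 0, then B_(k+1) = A_k B_1 + B_k A_1 would propagate 0 up to [B n], which is the
   identity. *)
have B1_neq0 : B 1%N != 0.
  apply/eqP=> B1; have Bk k : (k <= n)%N -> B k = 0.
    elim: k => [//|k IH] kn; rewrite -addn1 -AB ?addn1 // B1 IH 1?ltnW //.
    by rewrite mulmx0 mul0mx addr0.
  have /matrixP/(_ (Ordinal n_gt0) (Ordinal n_gt0)) := Bk n (leqnn n).
  by rewrite Bn !mxE eqxx => /eqP; rewrite oner_eq0.
have [g Bg] : exists g : 'cV_n, B 1%N *m g != 0.
  have /matrix0Pn[i [j Bij]] := B1_neq0; exists (delta_mx j 0).
  by rewrite -colE; apply/cV0Pn; exists i; rewrite mxE.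
have [a av] := unit_vector Bg; set v := a *: _ in av.
have Bv k : (k < n)%N -> B k *m v = 0.
  by move=> kn; rewrite /v -scalemxAr mulmxA BB ?addn1 // mul0mx scaler0.
have AAv k l : (k <= n)%N -> (l < n)%N ->
    A k *m (A l *m v) = if (k + l < n)%N then A (k + l)%N *m v else 0.
  move=> kn ln; rewrite mulmxA; case: ltnP => [kl|nkl]; first by rewrite AA 1?ltnW.
  (* The product rule stops at [n], so [A k] is split to bring out A_(n-l) A_l = A_n = 0. *)
  have -> : A k = A (k + l - n)%N *m A (n - l)%N by rewrite AA; [congr A|]; lia.
  have AnA : A (n - l)%N *m A l = 0 by rewrite AA subnK ?An // ltnW.
  by rewrite -(mulmxA (A _)) AnA mulmx0 mul0mx.
have ortho_le (i j : 'I_n) : (j <= i)%N ->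
    dot (A i *m v) (A j *m v) = (i == j)%:R.
  move=> ji; have le_n : (n - i + j <= n)%N by have := ltn_ord i; lia.
  rewrite dot_mulmx A_adj 1?ltnW // mulmxA.
  (* The mixed relation is used with indices n - i and j; its other term dies on [v] because j <
     n. *)
  have -> : B (n - i)%N *m A j = B (n - i + j)%N - A (n - i)%N *m B j.
    by rewrite -AB // addrAC subrr add0r.
  rewrite mulmxBl -mulmxA (Bv j) // mulmx0 subr0.
  have [<-|ij] := eqVneq i j; first by rewrite subnK 1?ltnW // Bn mul1mx.
  rewrite Bv ?dot0r //; move: ij; rewrite -val_eqE /= => ij; have := ltn_ord i; lia.
have ortho (i j : 'I_n) : dot (A i *m v) (A j *m v) = (i == j)%:R.
  have [/ortho_le//|/ltnW/ortho_le ij] := leqP j i.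
  by rewrite -dot_conj ij eq_sym conjC_nat.
have := orthonormal_unitary ortho; set V := (\matrix_(i, j) _) => uV.
exists V => // k kn; have [VV _] := uV.
rewrite -[A k]mulmx1 -VV mulmxA; congr (_ *m _); apply/matrixP=> i j.
have -> : (A k *m V) i j = (A k *m (A j *m v)) i 0.
  by rewrite !mxE; apply: eq_bigr => l _; rewrite mxE.
rewrite AAv // [RHS]mxE.
(* Column [j] of both sides is A_(j+k) v, or 0 when j + k >= n. *)
transitivity (\sum_(l < n) (l == (j + k)%N :> nat)%:R * (A l *m v) i 0).
  by rewrite (sum_delta _ _ (fun l => (A l *m v) i 0)) addnC; case: ifP; rewrite ?mxE.
by apply: eq_bigr => l _; rewrite [V _ _]mxE [shift _ _ _ _ _]mxE mulrC.
Qed.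
End ShiftRelations.

(** * The isometry on circulants and on powers of the shift *)

Section Isometry.
Variables (C : numClosedFieldType) (n : nat) (phi : 'M[C]_n -> 'M[C]_n).
Hypothesis n_gt0 : (0 < n)%N.
Hypothesis phi_lin : forall (a : C) (S T : 'M[C]_n), toeplitz S -> toeplitz T ->
  phi (a *: S + T) = a *: phi S + phi T.
Hypothesis phi_iso : forall (T : 'M[C]_n) (c : C), toeplitz T ->
  (is_opnorm (phi T) c <-> is_opnorm T c).

Lemma isometry_circulant (w : C) : `|w| = 1 ->
  exists X Y (mu : 'I_n -> C), [/\ unitary X, unitary Y,
    phi 1%:M = Y *m X^t*,
    forall j, `|mu j| = 1 /\ mu j ^+ n = w &
    forall k, (k <= n)%N -> phi (shift C n k) + w *: phi (shift C n (n - k))^T =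
      Y *m diag_mx (\row_j mu j ^+ k) *m X^t*].
Proof.
move=> w1; have [M [mu [uM mu1 tM cM]]] := fourier_circulant n_gt0 w1.
have [X [Y [uX uY phiM]]] := isometry_diag phi_lin phi_iso uM tM.
exists X, Y, mu; split=> // [|k kn].
  have one : 1%:M = M *m diag_mx (const_mx 1) *m M^t*.
    by rewrite diag_const_mx mulmx1 uM.1.
  by rewrite one phiM diag_const_mx mulmx1.
rewrite -phiM -cM // addrC -phi_lin 1?addrC //.
  by apply/toeplitz_tr/toeplitz_shift.
exact: toeplitz_shift.
Qed.

Lemma isometry_one_unitary : unitary (phi 1%:M).
Proof.
have [X [Y [mu [uX uY -> _ _]]]] := isometry_circulant (normr1 C).
by apply: unitary_mul => //; apply: unitary_adjoint.
Qed.

Let A k : 'M[C]_n := (phi 1%:M)^t* *m phi (shift C n k).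
Let B k : 'M[C]_n := (phi 1%:M)^t* *m phi (shift C n (n - k))^T.

(** Since phi(1) = Y X^*, multiplying by its adjoint turns [Y] into [X], so the images are diagonal
    in one orthonormal basis, with eigenvalues mu_j^k. Exponents add under products, and the
    conjugate of mu_j^k is w^* mu_j^(n-k). *)
Lemma circulant_image (w : C) : `|w| = 1 ->
  [/\ forall k l, (k + l <= n)%N ->
        (A k + w *: B k) *m (A l + w *: B l) = A (k + l)%N + w *: B (k + l)%N &
      forall k, (k <= n)%N ->
        (A k + w *: B k)^t* = w^* *: (A (n - k)%N + w *: B (n - k)%N)].
Proof.
move=> w1.
have [X [Y [mu [[XX XX'] [YY YY'] W mu1 phiC]]]] := isometry_circulant w1.
have AB k : (k <= n)%N ->
    A k + w *: B k = X *m diag_mx (\row_j mu j ^+ k) *m X^t*.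
  move=> kn; rewrite /A /B scalemxAr -mulmxDr phiC // W adjoint_mul trmxCK.
  by rewrite !mulmxA -(mulmxA X) YY' mulmx1.
split=> [k l kl|k kn].
  rewrite !AB //; [|lia|lia].
  rewrite !mulmxA -(mulmxA _ (X^t*)) XX' mulmx1 -(mulmxA X) mulmx_diag.
  by congr (_ *m diag_mx _ *m _); apply/rowP=> j; rewrite !mxE exprD.
rewrite !AB ?leq_subr // !adjoint_mul trmxCK tr_diag_mx map_diag_mx mulmxA.
rewrite scalemxAl scalemxAr; congr (_ *m _ *m _).
rewrite -linearZ; congr diag_mx; apply/rowP=> j; rewrite !mxE.
have [mu1j mu_n] := mu1 j.
have mumu : (mu j)^* * mu j = 1 by rewrite -normCKC mu1j expr1n.
rewrite -mu_n !rmorphXn /=.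
have -> : (mu j)^* ^+ n = (mu j)^* ^+ k * (mu j)^* ^+ (n - k).
  by rewrite -exprD subnKC.
by rewrite -mulrA -exprMn mumu expr1n mulr1.
Qed.

Lemma isometry_shift : exists2 V, unitary V & forall k, (k <= n)%N ->
  phi (shift C n k) = phi 1%:M *m V *m shift C n k *m V^t* /\
  phi (shift C n k)^T = phi 1%:M *m V *m (shift C n k)^T *m V^t*.
Proof.
have [WW WW'] := isometry_one_unitary.
(* Expanded, the product rule is a polynomial of degree 2 in [w] that vanishes on the unit
   circle. *)
have rel w k l : `|w| = 1 -> (k + l <= n)%N ->
    (A k *m A l - A (k + l)%N) + w *: (A k *m B l + B k *m A l - B (k + l)%N)
      + w ^+ 2 *: (B k *m B l) = 0.
  move=> w1 kl; have [/(_ k l kl) + _] := circulant_image w1.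
  move/eqP; rewrite -subr_eq0 => /eqP <-.
  rewrite mulmxDl !mulmxDr -!scalemxAl -!scalemxAr scalerA -expr2.
  rewrite scalerBr scalerDr opprD.
  by rewrite !addrA; apply/matrixP=> i j; rewrite !mxE; ring.
have AA k l (kl : (k + l <= n)%N) := unit_circle_poly2 (fun w w1 => rel w k l w1 kl).
have A_adj k : (k <= n)%N -> (A k)^t* = B (n - k)%N.
  move=> kn; have /unit_circle_poly2[/eqP + _ _] : forall w : C, `|w| = 1 ->
    ((A k)^t* - B (n - k)%N) + w *: ((B k)^t* - A (n - k)%N) + w ^+ 2 *: 0 = 0.
    move=> w w1; rewrite scaler0 addr0.
    (* Taking the conjugate of [w] makes the adjoint relation polynomial in [w]: A_k^* + w B_k^* = w
       A_(n-k) + B_(n-k). *)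
    have [|_ /(_ k kn)/eqP] := @circulant_image (w^*); first by rewrite norm_conjC.
    rewrite -subr_eq0 => /eqP <-; rewrite conjCK.
    have -> : (A k + w^* *: B k)^t* = (A k)^t* + w *: (B k)^t*.
      by apply/matrixP=> i j; rewrite !mxE rmorphD rmorphM /= conjCK.
    rewrite [w *: (_ + _ *: _)]scalerDr scalerA -normCK w1 expr1n scale1r.
    move: ((A k)^t*) ((B k)^t*) (A _) (B _) => X Y A' B'.
    by apply/matrixP=> i j; rewrite !mxE; ring.
  by rewrite subr_eq0 => /eqP.
have [|||k l /AA[/eqP + _ _]|k l /AA[_ /eqP + _]|k l /AA[]||V uV AV] :=
  @shift_model _ _ A B; rewrite ?subr_eq0 //.
- by rewrite /A shift0.
- by rewrite /B subnn shift0 trmx1.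
- by rewrite /A shift_large // (toeplitz_lin0 phi_lin) mulmx0.
- by move/eqP.
- by move/eqP.
have W (T : 'M[C]_n) : phi 1%:M *m ((phi 1%:M)^t* *m T) = T.
  by rewrite mulmxA WW mul1mx.
exists V => // k kn; split; first by rewrite -[LHS]W -/(A k) AV // !mulmxA.
(* Because B_(n-k) = A_k^*, the formula for the transposed shifts is the adjoint of the one for
   [A k]. *)
have kE : (phi 1%:M)^t* *m phi (shift C n k)^T = (A k)^t*.
  by rewrite A_adj // /B subKn.
have real_shift : (shift C n k)^t* = (shift C n k)^T.
  by apply/matrixP=> i j; rewrite !mxE conjC_nat.
by rewrite -[LHS]W kE AV // !adjoint_mul trmxCK real_shift !mulmxA.
Qed.
End Isometry.

Theorem theorem5p4 (C : numClosedFieldType) (n : nat) (phi : 'M[C]_n -> 'M[C]_n)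
  (phi_lin : forall (a : C) (S T : 'M[C]_n), toeplitz S -> toeplitz T ->
               phi (a *: S + T) = a *: phi S + phi T)
  (phi_iso : forall (T : 'M[C]_n) (c : C), toeplitz T ->
               (is_opnorm (phi T) c <-> is_opnorm T c)) :
  exists U V : 'M[C]_n, [/\ unitary U, unitary V &
    forall T : 'M[C]_n, toeplitz T -> phi T = U *m T *m V].
Proof.
have [n0|n_gt0] := posnP n.
  have all_eq (S T : 'M[C]_n) : S = T.
    by apply/matrixP=> i; have := ltn_ord i; rewrite {2}n0.
  by exists 1%:M, 1%:M; split; try split.
have [V uV phi_shift] := isometry_shift n_gt0 phi_lin phi_iso.
exists (phi 1%:M *m V), (V^t*); split.
- by apply: unitary_mul => //; apply: isometry_one_unitary phi_lin phi_iso.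
- exact: unitary_adjoint.
move=> T /(toeplitz_basis n_gt0)[a [b ->]].
have tS k : toeplitz (shift C n k) by apply: toeplitz_shift.
have tST k : toeplitz (shift C n k)^T by apply: toeplitz_tr.
rewrite (toeplitz_lin_sum phi_lin) => [|k]; last by apply: toeplitzD; apply: toeplitzZ.
rewrite mulmx_sumr mulmx_suml; apply: eq_bigr => k _.
have [phiS phiST] := phi_shift k (ltnW (ltn_ord k)).
rewrite phi_lin ?(toeplitz_linZ phi_lin) //; last exact: toeplitzZ.
by rewrite phiS phiST mulmxDr mulmxDl -!scalemxAr -!scalemxAl.
Qed.
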